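(* Suppose $\mu^*\in\mathcal{P}(\mathcal{X})$ is optimal, i.e. $J(\nu)\ge J(\mu^* )$ for all $\nu\in\mathcal{P}(\mathcal{X})$, and the von Mises derivative of $J$ exists at $\mu^*$. The support of $\mu^*$ satisfies $$\mathrm{supp}(\mu^* )\subseteq\{x\in\mathcal{X}:h_{\mu^*}(x)=0\}\qquad\mu^*\text{-a.s.}$$ Moreover, if $h_{\mu^*}$ is differentiable, then $$\mathrm{supp}(\mu^* )\subseteq\{x\in\mathcal{X}:\nabla h_{\mu^*}(x)=0\}\qquad\mu^*\text{-a.s.}$$
   Context: $\mathcal{X}$ is a nonempty compact subset of $\mathbb{R}^d$, $\mathcal{P}(\mathcal{X})$ is the set of Borel probability measures on $\mathcal{X}$, $\delta_x$ is the Dirac measure at $x$, and $J:\mathcal{P}(\mathcal{X})\to\mathbb{R}$. The influence function of $J$ at $\mu$ is $h_\mu(x)=\lim_{t\to0^+}\frac1t\{J(\mu+t(\delta_x-\mu))-J(\mu)\}$, $x\in\mathcal{X}$. The von Mises derivative of $J$ at $\mu$ is $J'_\mu(\nu)=\lim_{t\to0^+}\frac1t\{J(\mu+t(\nu-\mu))-J(\mu)\}$, $\nu\in\mathcal{P}(\mathcal{X})$; it exists at $\mu$ if these limits exist and there is a measurable $\phi_\mu:\mathcal{X}\to\mathbb{R}$, integrable with respect to every $\nu\in\mathcal{P}(\mathcal{X})$, with $J'_\mu(\nu)=\int\phi_\mu\,\mathrm{d}(\nu-\mu)$ for all $\nu\in\mathcal{P}(\mathcal{X})$. The support $\mathrm{supp}(\mu)$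 is the set of $x\in\mathcal{X}$ such that every open neighborhood of $x$ has positive $\mu$-measure. An inclusion $A\subseteq B$ ''$\mu^*$-a.s.'' means $\mu^*(A\setminus B)=0$.
   Formalization: The second inclusion is stated only for support points in the interior of X, with h differentiable there; at boundary points it is false: X=[0,1], J(μ)=∫x dμ, μ*=δ_0 gives h(x)=x, so h'(0)=1 although supp(μ* )={0}. *)

(* Defs.v *)
From HB Require Import structures.
From mathcomp Require Import all_boot all_order all_algebra.
From mathcomp Require Import all_classical all_reals all_analysis.

Set Implicit Arguments.
Unset Strict Implicit.
Unset Printing Implicit Defensive.

Import Order.TTheory GRing.Theory Num.Theory.
Import numFieldNormedType.Exports.

Local Open Scope classical_set_scope.
Local Open Scope ring_scope.

(* The subset X as a type, with the topology induced by T and the Borel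
   sigma-algebra of that topology. The library's measurable types are pointed,
   hence the parameter X0. *)
Definition subspace_of (T : topologicalType) (X : set T) (X0 : X !=set0) : Type :=
  set_type X.

Section borel_subspace.
Context (T : topologicalType) (X : set T) (X0 : X !=set0).

HB.instance Definition _ := Topological.copy (subspace_of X0)
  (initial_topology (set_val : X -> T)).

Let point_of : subspace_of X0 := 
  exist (fun x => x \in X) (projT1 (cid X0)) (mem_set (projT2 (cid X0))).

HB.instance Definition _ := isPointed.Build (subspace_of X0) point_of.

HB.instance Definition _ := Measurable.copy (subspace_of X0)
  (g_sigma_algebraType (@open (subspace_of X0))).

End borel_subspace.

Section mixture.
Context d (T : measurableType d) (R : realType).

(* t clamped to [0, 1], so that mixture below is total in t *)
Definition clamp01 (t : R) : R := Num.min 1 (Num.max 0 t).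

Lemma clamp01_ge0 t : 0 <= clamp01 t.
Proof. by rewrite /clamp01 le_min ler01 le_max lexx. Qed.

Lemma clamp01_le1 t : clamp01 t <= 1.
Proof. by rewrite /clamp01 ge_min lexx. Qed.

Lemma onem_clamp01_ge0 t : 0 <= 1 - clamp01 t.
Proof. by rewrite subr_ge0 clamp01_le1. Qed.

Lemma clamp01_id t : 0 <= t <= 1 -> clamp01 t = t.
Proof. by case/andP=> t0 t1; rewrite /clamp01 max_r// min_r. Qed.

(* mu + t (nu - mu) *)
Definition mixture (t : R) (mu nu : probability T R) : set T -> \bar R :=
  measure_add (mscale (NngNum (onem_clamp01_ge0 t)) mu)
              (mscale (NngNum (clamp01_ge0 t)) nu).

HB.instance Definition _ t mu nu := isMeasure.Build _ _ _ (mixture t mu nu)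
  (measure0 _) (measure_ge0 _) (@measure_semi_sigma_additive _ _ _ _).

Let mixture_setT t mu nu : mixture t mu nu setT = 1%E.
Proof.
rewrite /mixture measure_addE; rewrite /= /mscale/=.
by rewrite !probability_setT !mule1 -EFinD subrK.
Qed.

HB.instance Definition _ t mu nu :=
  Measure_isProbability.Build _ _ _ (mixture t mu nu) (mixture_setT t mu nu).

Lemma mixtureE t mu nu A : 0 <= t <= 1 ->
  mixture t mu nu A = ((1 - t)%:E * mu A + t%:E * nu A)%E.
Proof. by move=> t01; rewrite /mixture measure_addE/= /mscale/= clamp01_id. Qed.

End mixture.

Section von_mises.
Context d (T : measurableType d) (R : realType).
Implicit Types (J : probability T R -> R) (mu nu : probability T R).

Definition diff_quotient J mu nu (t : R) : R :=
  t^-1 * (J (mixture t mu nu) - J mu).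

Definition influence_function J mu (x : T) : R :=
  lim (diff_quotient J mu (dirac x) t @[t --> 0^'+]).

Definition von_mises_derivative J mu nu : R :=
  lim (diff_quotient J mu nu t @[t --> 0^'+]).

Definition von_mises_differentiable J mu : Prop :=
  (forall nu, cvg (diff_quotient J mu nu t @[t --> 0^'+])) /\
  exists phi : T -> R,
    [/\ measurable_fun setT phi,
        forall nu, nu.-integrable setT (EFin \o phi) &
        forall nu, von_mises_derivative J mu nu =
                   \int[nu]_x phi x - \int[mu]_x phi x].

(* The values of mu on non-measurable sets are unconstrained, hence the first
   conjunct. *)
Definition as_subset mu (A B : set T) : Prop :=
  measurable (A `\` B) /\ mu (A `\` B) = 0%E.

End von_mises.

Definition measure_support (R : realType) (T : topologicalType) (X : set T)
    (X0 : X !=set0) (mu : probability (subspace_of X0) R) :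
    set (subspace_of X0) :=
  [set x | forall U, open U -> U x -> (0 < mu U)%E].

Definition gradient (R : realType) (d : nat) (f : 'rV[R]_d -> R)
    (x : 'rV[R]_d) : 'rV[R]_d :=
  \row_(i < d) 'D_(delta_mx ord0 i) f x.

Section on_subspace.
Context (R : realType) (d : nat) (X : set 'rV[R]_d) (X0 : X !=set0).

(* extension by 0; at a point of X°, differentiability and the gradient do not
   depend on the values outside X *)
Definition extend0 (h : subspace_of X0 -> R) : 'rV[R]_d -> R := 'valL_0 h.

Definition interior_points : set (subspace_of X0) :=
  [set x | X° (set_val x)].

(* A function on X has a classical derivative only at points of X°. *)
Definition differentiable_on_interior (h : subspace_of X0 -> R) : Prop :=
  forall x, interior_points x -> differentiable (extend0 h) (set_val x).

Definition critical_points (h : subspace_of X0 -> R) : set (subspace_of X0) :=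
  [set x | gradient (extend0 h) (set_val x) = 0].

End on_subspace.

Arguments interior_points {R d X} X0.

(* Main.v *)
(* Write h for the influence function. Optimality makes one-sided derivatives
   of J at mu nonnegative, in particular h >= 0. Since h = phi - \int phi dmu,
   the mu-integral of h is 0, so h = 0 mu-a.e., which is the first inclusion.
   Extended by 0, h stays nonnegative, so its zeros are global minima, and those
   in the interior of X are critical: the second exceptional set lies in the
   null set {h != 0}. It is Borel because partial derivatives are limits of
   sequences of difference quotients. *)

Require Import Defs.
From HB Require Import structures.
From mathcomp Require Import all_boot all_order all_algebra.
From mathcomp Require Import all_classical all_reals all_analysis.
From mathcomp Require Import measurable_realfun.

Set Implicit Arguments.
Unset Strict Implicit.
Unset Printing Implicit Defensive.

Import Order.TTheory GRing.Theory Num.Theory.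
Import numFieldNormedType.Exports.

Local Open Scope classical_set_scope.
Local Open Scope ring_scope.

Lemma open_measurable_subspace (T : topologicalType) (X : set T)
    (X0 : X !=set0) (U : set (subspace_of X0)) : open U -> measurable U.
Proof. exact: sub_sigma_algebra. Qed.

(** The complement is the union of all open [mu]-null sets, hence open. *)
Lemma measurable_support (R : realType) (T : topologicalType) (X : set T)
    (X0 : X !=set0) (mu : probability (subspace_of X0) R) :
  measurable (measure_support mu).
Proof.
rewrite -[measure_support mu]setCK; apply: measurableC.
apply: open_measurable_subspace.
rewrite (_ : ~` _ = \bigcup_(U in [set U | open U /\ mu U = 0%E]) U).
  by apply: bigcup_open => U [].
apply/seteqP; split=> [x|x [U [oU muU0] Ux]] /=.
  move=> /existsNP[U /not_implyP[oU /not_implyP[Ux /negP]]].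
  rewrite -leNgt => muU; exists U => //; split => //.
  by apply/eqP; rewrite eq_le muU measure_ge0.
by move=> /(_ U oU Ux); rewrite muU0 ltxx.
Qed.

Section von_mises_at_minimum.
Context d (T : measurableType d) (R : realType).
Variables (J : probability T R -> R) (mu : probability T R).
Hypothesis mu_opt : forall nu, J mu <= J nu.

Lemma von_mises_derivative_ge0 nu :
  cvg (diff_quotient J mu nu t @[t --> 0^'+]) ->
  0 <= von_mises_derivative J mu nu.
Proof.
move=> cJ; apply: limr_ge => //; near=> t.
by rewrite /diff_quotient mulr_ge0 ?invr_ge0 ?subr_ge0.
Unshelve. all: by end_near. Qed.

Hypothesis mu_vM : von_mises_differentiable J mu.

Lemma influence_function_ge0 x : 0 <= influence_function J mu x.
Proof. by apply: (@von_mises_derivative_ge0 (dirac x)); case: mu_vM. Qed.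

(** The influence function at [x] is the von Mises derivative in the direction [dirac x], against
    which [phi] integrates to [phi x]. *)
Lemma influence_functionE (phi : T -> R) :
  measurable_fun setT phi ->
  (forall nu, von_mises_derivative J mu nu =
              \int[nu]_x phi x - \int[mu]_x phi x) ->
  influence_function J mu = fun x => phi x - \int[mu]_y phi y.
Proof.
move=> mphi phiE; apply/funext => x.
have := phiE (dirac x); rewrite /von_mises_derivative /influence_function => ->.
rewrite [in X in X - _]/Rintegral integral_dirac//; last exact/measurable_EFinP.
by rewrite diracT mul1e.
Qed.

Lemma measurable_influence_function :
  measurable_fun setT (influence_function J mu).
Proof.
have [_ [phi [mphi _ /(influence_functionE mphi) ->]]] := mu_vM.
exact: measurable_funB.
Qed.

Lemma influence_function_ae0 :
  {ae mu, forall x, influence_function J mu x = 0}.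
Proof.
have [_ [phi [mphi iphi phiE]]] := mu_vM.
have hE := influence_functionE mphi phiE.
have int0 : (\int[mu]_x `|(influence_function J mu x)%:E| = 0)%E.
  rewrite (eq_integral (EFin \o influence_function J mu)); last first.
    by move=> x _; rewrite /= ger0_norm// influence_function_ge0.
  under eq_integral do rewrite hE /= EFinB.
  have fin_cst : mu.-integrable setT (cst (\int[mu]_y phi y)%:E).
    exact: finite_measure_integrable_cst.
  (* The centring constant is the [fine] part of this integral; finiteness lets the two cancel,
     since [mu] has mass 1. *)
  have phi_fin : (\int[mu]_x (phi x)%:E)%E \is a fin_num.
    by apply: integrable_fin_num => //; exact: iphi.
  rewrite integralB_EFin//; last exact: iphi.
  rewrite integral_cst//= [X in (_ * X)%E](_ : _ = 1%E).
    by rewrite mule1 fineK ?subee.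
  exact: probability_setT.
have mh : measurable_fun setT (EFin \o influence_function J mu).
  exact/measurable_EFinP/measurable_influence_function.
have [/(_ int0) + _] := ae_eq_integral_abs mu measurableT mh.
by apply: filterS => x /(_ I) [].
Qed.

End von_mises_at_minimum.

Section extension.
Context (R : realType) (n : nat) (X : set 'rV[R]_n) (X0 : X !=set0).
Implicit Type h : subspace_of X0 -> R.

Lemma extend0_val h x : extend0 h (set_val x) = h x.
Proof. by have := congr1 (@^~ x) (valLK 0 h). Qed.

Lemma extend0_out h y : y \notin X -> extend0 h y = 0.
Proof. by move=> yX; rewrite /extend0 /valL_ oinv_set_val/= insubN. Qed.

Lemma extend0_ge0 h : (forall x, 0 <= h x) -> forall y, 0 <= extend0 h y.
Proof.
move=> h0 y; have [yX|yX] := boolP (y \in X); last by rewrite extend0_out.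
by rewrite -[y]/(set_val (SigSub yX : subspace_of X0)) extend0_val.
Qed.

(** Needed for difference quotients of the extension: [set_val x + v] may leave [X], so the points
    where it stays in [X] are treated apart. *)
Lemma measurable_extend0_shift h (v : 'rV[R]_n) : closed X ->
  measurable_fun setT h ->
  measurable_fun setT (fun x : subspace_of X0 => extend0 h (set_val x + v)).
Proof.
move=> clX mh.
pose D : set (subspace_of X0) := [set x | X (set_val x + v)].
pose shift (x : subspace_of X0) : subspace_of X0 := insubd x (set_val x + v).
have shift_cont (A : set 'rV[R]_n) : open A ->
    open [set x : subspace_of X0 | A (set_val x + v)].
  move=> oA; exists ((+%R^~ v) @^-1` A) => //.
  apply: open_comp => // x _.
  exact: (@cvgD _ _ _ (nbhs x) _ id (cst v) x v cvg_id (cvg_cst v)).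
have mD : measurable D.
  rewrite -[D]setCK; apply: measurableC; apply: open_measurable_subspace.
  exact/(shift_cont (~` X))/closed_openC.
have val_shift x : D x -> set_val (shift x) = set_val x + v.
  by move=> Dx; apply: insubdK; exact: mem_set.
have mshift : measurable_fun D shift.
  apply: (measurability (@open (subspace_of X0))) => //.
  move=> _ [_ [A oA <-] <-].
  rewrite (_ : _ `&` _ = D `&` [set x | A (set_val x + v)]).
    apply: measurableI => //; apply: open_measurable_subspace.
    exact: shift_cont.
  by apply/seteqP; split=> x [Dx]; rewrite /= val_shift.
(* Off [D] both the restriction of [h \o shift] and the extension are 0. *)
have /(measurable_restrictT _ mD) := measurableT_comp mh mshift.
apply: eq_measurable_fun => x _; rewrite patchE; case: ifPn => [|/negP xD].
  by rewrite inE => Dx; rewrite -(val_shift _ Dx) extend0_val.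
by rewrite extend0_out//; apply/negP => /set_mem xX; apply/xD/mem_set.
Qed.

Lemma measurable_derive_extend0 h (v : 'rV[R]_n) : closed X ->
  measurable_fun setT h ->
  (forall x, interior_points X0 x -> derivable (extend0 h) (set_val x) v) ->
  measurable_fun (interior_points X0)
                 (fun x : subspace_of X0 => 'D_v (extend0 h) (set_val x)).
Proof.
move=> clX mh dh.
(* The increments 1/(m+1) are nonzero and tend to 0, so the limit over the punctured neighbourhood
   of 0 applies to them. *)
pose q (m : nat) (x : subspace_of X0) :=
  m.+1%:R * (extend0 h (set_val x + m.+1%:R^-1 *: v) - h x).
apply: (@measurable_fun_cvg _ _ _ _ q) => [m|x /dh dx].
  apply: measurable_funTS; apply: measurable_funM => //.
  by apply: measurable_funB => //; exact: measurable_extend0_shift.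
have harm0 : (forall m, harmonic m != 0 :> R) /\ @harmonic R @ \oo --> 0.
  by split=> [m|]; [rewrite /harmonic /= invr_neq0|exact: cvg_harmonic].
have qE : q ^~ x = (fun t => t^-1 *: ((extend0 h \o shift (set_val x)) (t *: v)
    - extend0 h (set_val x))) \o harmonic.
  by apply/funext => m; rewrite /q /= extend0_val invrK (addrC (set_val x)).
by rewrite qE; exact: (cvgr_dnbhsP _ _ _).1 dx _ harm0.
Qed.

End extension.

(** At a minimum the difference quotients are nonpositive for t < 0 and nonnegative for t > 0, and
    both one-sided limits equal the derivative. *)
Lemma derive_global_min (R : realType) (V : normedModType R) (f : V -> R) a v :
  derivable f a v -> (forall y, f a <= f y) -> 'D_v f a = 0.
Proof.
move=> df fmin; apply/eqP; rewrite eq_le; apply/andP; split.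
  apply: (@cvgr_to_le _ (0^'-) _ R _ _ 0 (cvg_dnbhs_at_left df)).
  near=> t; apply: mulr_le0_ge0; last by rewrite subr_ge0 fmin.
  by rewrite invr_le0; near: t; exact: nbhs_left_le.
apply: (@cvgr_to_ge _ (0^'+) _ R _ _ 0 (cvg_dnbhs_at_right df)).
near=> t; apply: mulr_ge0; last by rewrite subr_ge0 fmin.
by rewrite invr_ge0; near: t; exact: nbhs_right_ge.
Unshelve. all: by end_near. Qed.

Theorem lemma2 (R : realType) (d : nat) (X : set 'rV[R]_d)
    (X0 : X !=set0) (cX : compact X)
    (J : probability (subspace_of X0) R -> R)
    (mu : probability (subspace_of X0) R)
    (mu_opt : forall nu : probability (subspace_of X0) R, J nu >= J mu)
    (mu_vM : von_mises_differentiable J mu) :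
  as_subset mu (measure_support mu) [set x | influence_function J mu x = 0] /\
  (differentiable_on_interior (influence_function J mu) ->
   as_subset mu (measure_support mu `&` interior_points X0)
                (critical_points (influence_function J mu))).
Proof.
have clX : closed X by apply: compact_closed cX; exact: norm_hausdorff.
set h := influence_function J mu.
have h0 : forall x, 0 <= h x by exact: influence_function_ge0.
have mh : measurable_fun setT h by exact: measurable_influence_function.
have hN : mu.-negligible (~` [set x | h x = 0]).
  exact: influence_function_ae0.
have mS := measurable_support mu.
split=> [|dh].
  have mA : measurable (measure_support mu `\` [set x | h x = 0]).
    apply: measurableD => //; rewrite -[X in measurable X]setTI.
    exact: (mh measurableT [set 0] (measurable_set1 0)).
  by split=> //; apply: (measure_negligible mA); apply: negligibleS hN => x [].
have mI : measurable (interior_points X0).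
  by apply: open_measurable_subspace; exists X° => //; exact: open_interior.
pose D i (x : subspace_of X0) : R :=
  'D_(delta_mx ord0 i) (extend0 h) (set_val x).
have mD i : measurable_fun (interior_points X0) (D i).
  apply: measurable_derive_extend0 => // x /dh; exact: diff_derivable.
(* A gradient is nonzero when some coordinate is. The interior is grouped with the preimage because
   [D i] is known to be measurable only there. *)
have AE : (measure_support mu `&` interior_points X0) `\` critical_points h =
    \bigcup_(i : 'I_d) (measure_support mu `&`
       (interior_points X0 `&` (D i @^-1` (~` [set 0])))).
  apply/seteqP; split=> [x [[Sx Ix] crit]|x [i _ [Sx [Ix Dx]]]].
    apply: contrapT => noD; apply: crit; apply/rowP => i; rewrite !mxE.
    by apply: contrapT => Dx; apply: noD; exists i.
  by split=> // /rowP /(_ i); rewrite !mxE.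
have mA : measurable
    ((measure_support mu `&` interior_points X0) `\` critical_points h).
  rewrite AE; apply: fin_bigcup_measurable => [|i _].
    exact: finite_finset.
  by apply: measurableI => //; apply: mD => //; exact: measurableC.
split=> //; apply: (measure_negligible mA); apply: negligibleS hN.
(* By contraposition: an interior zero of [h] minimises the nonnegative extension over the whole
   space, so each partial derivative vanishes there. *)
move=> x [[_ /dh dx] crit] hx0; apply: crit.
apply/rowP => i; rewrite !mxE; apply: derive_global_min.
  exact: diff_derivable.
by rewrite extend0_val hx0; exact: extend0_ge0.
Qed.
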